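(* Let $T>0$, $x_0,x_T\in\mathbb R^n$, $\underline u_j,\overline u_j\in\mathbb R$ ($j=1,\dots,m$), and let $f=(f_1,\dots,f_n):\mathbb R^n\times\mathbb R^m\times[0,T]\to\mathbb R^n$ be continuous, with each $f_i(x,u,t)$ quasidifferentiable and locally Lipschitz continuous in $(x,u)$ for each $t\in[0,T]$. Let $$U=\{u\in P_m[0,T]\mid \underline u_j\le u_j(t)\le\overline u_j,\ j=1,\dots,m,\ t\in[0,T]\},$$ and suppose that there exists a control in $U$ for which the corresponding trajectory of $\dot x(t)=f(x(t),u(t),t)$, $x(0)=x_0$, satisfies $x(T)=x_T$. Let $I$, $\underline\partial\varphi$, $\overline\partial\varphi$ be the functional and the set-valued maps defined in the context. (Necessity) If a control $u^*\in U$ brings the system $\dot x(t)=f(x(t),u(t),t)$ from $x(0)=x_0$ to $x(T)=x_T$ in the time $T$, with corresponding trajectory $x^*$ and $z^*=\dot x^*$, then, with $\xi^*=(x^*,z^*,u^* )$, for each measurable selection $w(\cdot)$ of the set-valued mapping $t\mapsto\overline\partial\varphi(\xi^*,t)$ the inclusion $$-w(t)\in\underline\partial\varphi(\xi^*,t)$$ holds for almost every $t\in[0,T]$. (Sufficiency) If $\xi^*=(x^*,z^*,u^* )\in C_n[0,T]\times P_n[0,T]\times P_m[0,T]$ satisfies $I(x^*,z^*,u^* )=0$, then the condition that for each measurable selection $w(\cdot)$ of the set-valued mapping $t\mapsto\overline\partial\varphi(\xi^*,t)$ the inclusion $-w(t)\in\underline\partial\varphi(\xi^*,t)$ holds for almost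 every $t\in[0,T]$ is also sufficient for $u^*$ to belong to $U$ and to bring the system $\dot x(t)=f(x(t),u(t),t)$ from $x(0)=x_0$ to $x(T)=x_T$ in the time $T$.
   Context: $C_n[0,T]$ is the space of continuous functions $[0,T]\to\mathbb R^n$; $P_k[0,T]$ is the space of piecewise continuous functions $[0,T]\to\mathbb R^k$ (value at a discontinuity $t_0\in[0,T)$ is the right limit; value at $T$ is the left limit). Trajectories are continuous, piecewise continuously differentiable, and $\dot x\in P_n[0,T]$ with the same convention. Quasidifferentiability of $f_i$ at $(x,u)$, for given $t$: there are convex compact sets $\underline\partial f_i(x,u,t),\overline\partial f_i(x,u,t)\subset\mathbb R^n\times\mathbb R^m$ with $$\lim_{\alpha\downarrow0}\tfrac1\alpha\big(f_i(x+\alpha g_1,u+\alpha g_2,t)-f_i(x,u,t)\big)=\max_{v\in\underline\partial f_i(x,u,t)}\langle v,g\rangle+\min_{w\in\overline\partial f_i(x,u,t)}\langle w,g\rangle$$ for all $g=(g_1,g_2)\in\mathbb R^n\times\mathbb R^m$. Fix such a choice of sets for every $(x,u,t)$. Functional, for $(x,z,u)\in C_n[0,T]\times P_n[0,T]\times P_m[0,T]$ (the square of a vector is its squared Euclidean norm): $$I(x,z,u)=\sum_{i=1}^n\int_0^T|z_i(t)-f_i(x(t),u(t),t)|dt+\tfrac12\Big(x_0+\int_0^Tz(t)dt-x_T\Big)^2+\sum_{j=1}^m\int_0^T\max\{\underline u_j-u_j(t),0\}dt+\sum_{j=1}^m\int_0^T\max\{u_j(t)-\overline u_j,0\}dt+\tfrac12\int_0^T\Big(x(t)-x_0-\int_0^tz(\tau)d\tau\Big)^2dt.$$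 Set-valued maps. For $\xi=(x,z,u)$ and $t\in[0,T]$ put $\underline\partial\varphi(\xi,t)=\sum_{k=1}^4\underline\partial\varphi_k(x,z,u,t)$ and $\overline\partial\varphi(\xi,t)=\sum_{k=1}^4\overline\partial\varphi_k(x,z,u,t)$ (Minkowski sums of subsets of $\mathbb R^n\times\mathbb R^n\times\mathbb R^m$, vectors written as (x-part, z-part, u-part)), where the summands are as follows. Sets $\underline\partial f_i,\overline\partial f_i$ (evaluated at $(x(t),u(t),t)$) are regarded as subsets of $\mathbb R^n\times\mathbb R^n\times\mathbb R^m$ via $(a,b)\mapsto(a,0_n,b)$; $e_i$ denotes the vector with $1$ in the $(n+i)$-th coordinate and zeros elsewhere; $\epsilon_j$ denotes the vector with $1$ in the $(2n+j)$-th coordinate and zeros elsewhere; $\mathrm{co}$ is the convex hull of the union. - $\underline\partial\varphi_1=\sum_{i=1}^nA_i$, $\overline\partial\varphi_1=\sum_{i=1}^nB_i$, where, with $h_i=z_i(t)-f_i(x(t),u(t),t)$: if $h_i>0$, $A_i=e_i-\overline\partial f_i$, $B_i=-\underline\partial f_i$; if $h_i<0$, $A_i=-e_i+\underline\partial f_i$, $B_i=\overline\partial f_i$; if $h_i=0$, $A_i=\mathrm{co}\{e_i-2\overline\partial f_i,\ -e_i+2\underline\partial f_i\}$, $B_i=-\underline\partial f_i+\overline\partial f_i$. - $\underline\partial\varphi_2=\{(0_n,\ x_0+\int_0^Tz(\tau)d\tau-x_T,\ 0_m)\}$, $\overline\partial\varphi_2=\{0\}$. - $\underline\partial\varphi_3=\sum_{j=1}^m(C_j+D_j)$,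 $\overline\partial\varphi_3=\{0\}$, where $C_j=\{\epsilon_j\}$, $\{0\}$, or $\mathrm{co}\{\epsilon_j,0\}$ according as $u_j(t)-\overline u_j$ is $>0$, $<0$, or $=0$, and $D_j=\{-\epsilon_j\}$, $\{0\}$, or $\mathrm{co}\{-\epsilon_j,0\}$ according as $\underline u_j-u_j(t)$ is $>0$, $<0$, or $=0$. - $\underline\partial\varphi_4=\{(x(t)-x_0-\int_0^tz(\tau)d\tau,\ -\int_t^T(x(\tau)-x_0-\int_0^\tau z(s)ds)d\tau,\ 0_m)\}$, $\overline\partial\varphi_4=\{0\}$. *)

(* Defs.v *)
From HB Require Import structures.
From mathcomp Require Import all_boot all_order all_algebra.
From mathcomp Require Import all_classical all_reals all_analysis.
From mathcomp Require Import measurable_realfun.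
Set Implicit Arguments.
Unset Strict Implicit.
Unset Printing Implicit Defensive.
Import Order.TTheory GRing.Theory Num.Theory.
Import numFieldNormedType.Exports.
Local Open Scope classical_set_scope.
Local Open Scope ring_scope.

Definition dotv (R : realType) (k : nat) (v w : 'rV[R]_k) : R :=
  \sum_(i < k) v 0 i * w 0 i.

Definition sqnormv (R : realType) (k : nat) (v : 'rV[R]_k) : R := dotv v v.

Definition vintegral (R : realType) (k : nat) (a b : R) (y : R -> 'rV[R]_k) :
    'rV[R]_k :=
  \row_(i < k) \int[@lebesgue_measure R]_(t in `[a, b]) (y t 0 i).

Definition minkowski_add (V : zmodType) (A B : set V) : set V :=
  [set a + b | a in A & b in B].

Notation "\msum_ ( i < k ) A" := (\big[@minkowski_add _/[set 0]]_(i < k) A)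
  (at level 41, A at level 41, i, k at level 50).

Definition convex_hull (R : realType) (V : lmodType R) (A : set V) : set V :=
  \bigcap_(C in [set C : set V | convex_set C /\ A `<=` C]) C.

(* Functions on [0, T] are total functions on R, of which only the values on
   [0, T] are constrained and used. *)
Definition continuous_on (R : realType) (T : R) (k : nat) (y : R -> 'rV[R]_k) :=
  {within `[0, T], continuous y}.

(* At every point of [0, T[, discontinuity or not, the value is the right
   limit; at T it is the left limit. *)
Definition piecewise_continuous (R : realType) (T : R) (k : nat)
    (y : R -> 'rV[R]_k) :=
  [/\ forall t, t \in `[0, T[ -> y s @[s --> t^'+] --> y t,
      y s @[s --> T^'-] --> y T,
      forall t, t \in `]0, T[ -> cvg (y s @[s --> t^'-]) &
      exists D : seq R, forall t, t \in `]0, T[ -> t \notin D ->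
        {for t, continuous y}].

(* z is the derivative of x, extended to the points where x is not
   differentiable (and to 0 and T) by the convention of piecewise_continuous;
   this determines z on [0, T]. *)
Definition is_piecewise_derivative (R : realType) (T : R) (k : nat)
    (x z : R -> 'rV[R]_k) :=
  piecewise_continuous T z /\
  exists D : seq R, forall t : R, t \in `]0, T[ -> t \notin D ->
    is_derive t 1 x (z t).

(* A quasidifferential (subd, supd) of g at (x, u). For nonempty compact sets the sup and the inf below are attained: they are
   the max and the min of the definition of quasidifferentiability. *)
Definition is_quasidifferential (R : realType) (n m : nat)
    (g : 'rV[R]_n -> 'rV[R]_m -> R) (x : 'rV[R]_n) (u : 'rV[R]_m)
    (subd supd : set ('rV[R]_n * 'rV[R]_m)) :=
  let pairing (d v : 'rV[R]_n * 'rV[R]_m) := dotv v.1 d.1 + dotv v.2 d.2 in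
  [/\ [/\ subd !=set0, convex_set subd & compact subd],
      [/\ supd !=set0, convex_set supd & compact supd] &
      forall d : 'rV[R]_n * 'rV[R]_m,
        a^-1 * (g (x + a *: d.1) (u + a *: d.2) - g x u) @[a --> (0 : R)^'+]
          --> sup [set pairing d v | v in subd]
              + inf [set pairing d w | w in supd]].

Definition locally_lipschitz (R : realType) (V : normedModType R)
    (g : V -> R^o) :=
  forall p : V, exists2 A : set V, nbhs p A & [lipschitz g q | q in A].

Section control_problem.
Variables (R : realType) (n m : nat) (T : R) (x0 xT : 'rV[R]_n).
Variables (ulo uhi : 'rV[R]_m) (f : 'rV[R]_n -> 'rV[R]_m -> R -> 'rV[R]_n).
Variables (subf supf :
  'I_n -> 'rV[R]_n -> 'rV[R]_m -> R -> set ('rV[R]_n * 'rV[R]_m)).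

Definition rhs_continuous :=
  {within [set p : 'rV[R]_n * 'rV[R]_m * R | p.2 \in `[0, T]],
    continuous (fun p => f p.1.1 p.1.2 p.2)}.

Definition rhs_locally_lipschitz :=
  forall (i : 'I_n) (t : R), t \in `[0, T] ->
    @locally_lipschitz R ('rV[R]_n * 'rV[R]_m)%type
      (fun p => f p.1 p.2 t 0 i).

Definition rhs_quasidifferentials :=
  forall (i : 'I_n) (x : 'rV[R]_n) (u : 'rV[R]_m) (t : R), t \in `[0, T] ->
    is_quasidifferential (fun y v => f y v t 0 i) x u
      (subf i x u t) (supf i x u t).

Definition admissible_control (u : R -> 'rV[R]_m) :=
  piecewise_continuous T u /\
  forall (j : 'I_m) (t : R), t \in `[0, T] -> ulo 0 j <= u t 0 j <= uhi 0 j.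

(* x is a trajectory for u, with derivative z. *)
Definition trajectory (x z : R -> 'rV[R]_n) (u : R -> 'rV[R]_m) :=
  [/\ continuous_on T x, is_piecewise_derivative T x z, x 0 = x0 &
      forall t, t \in `[0, T] -> z t = f (x t) (u t) t].

Definition steers (u : R -> 'rV[R]_m) :=
  exists x z : R -> 'rV[R]_n, trajectory x z u /\ x T = xT.

Definition functional (x z : R -> 'rV[R]_n) (u : R -> 'rV[R]_m) : R :=
  let mu := @lebesgue_measure R in
  \sum_(i < n) \int[mu]_(t in `[0, T]) `|z t 0 i - f (x t) (u t) t 0 i|
  + 2^-1 * sqnormv (x0 + vintegral 0 T z - xT)
  + \sum_(j < m) \int[mu]_(t in `[0, T]) Num.max (ulo 0 j - u t 0 j) 0
  + \sum_(j < m) \int[mu]_(t in `[0, T]) Num.max (u t 0 j - uhi 0 j) 0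
  + 2^-1 * \int[mu]_(t in `[0, T]) sqnormv (x t - x0 - vintegral 0 t z).

(* The triples are the (x-part, z-part, u-part). *)
Local Notation E := ('rV[R]_n * 'rV[R]_n * 'rV[R]_m)%type.

Definition e_z (i : 'I_n) : E := (0, delta_mx 0 i, 0).
Definition e_u (j : 'I_m) : E := (0, 0, delta_mx 0 j).

Definition embed (A : set ('rV[R]_n * 'rV[R]_m)) : set E :=
  [set (ab.1, 0, ab.2) | ab in A].

Definition affine_image (c : E) (a : R) (A : set E) : set E :=
  [set c + a *: v | v in A].

Section summands.
Variables (x z : R -> 'rV[R]_n) (u : R -> 'rV[R]_m) (t : R).

Definition residual (i : 'I_n) : R := z t 0 i - f (x t) (u t) t 0 i.
Definition sub_f (i : 'I_n) : set E := embed (subf i (x t) (u t) t).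
Definition sup_f (i : 'I_n) : set E := embed (supf i (x t) (u t) t).

Definition subphi1_term (i : 'I_n) : set E :=
  if 0 < residual i then affine_image (e_z i) (-1) (sup_f i)
  else if residual i < 0 then affine_image (- e_z i) 1 (sub_f i)
  else convex_hull (affine_image (e_z i) (- 2) (sup_f i)
                    `|` affine_image (- e_z i) 2 (sub_f i)).

Definition supphi1_term (i : 'I_n) : set E :=
  if 0 < residual i then affine_image 0 (-1) (sub_f i)
  else if residual i < 0 then sup_f i
  else minkowski_add (affine_image 0 (-1) (sub_f i)) (sup_f i).

Definition subphi1 : set E := \msum_(i < n) subphi1_term i.
Definition supphi1 : set E := \msum_(i < n) supphi1_term i.

Definition subphi2 : set E := [set (0, x0 + vintegral 0 T z - xT, 0)].
Definition supphi2 : set E := [set 0].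

Definition subphi3_upper (j : 'I_m) : set E :=
  if 0 < u t 0 j - uhi 0 j then [set e_u j]
  else if u t 0 j - uhi 0 j < 0 then [set 0]
  else convex_hull [set e_u j; 0].

Definition subphi3_lower (j : 'I_m) : set E :=
  if 0 < ulo 0 j - u t 0 j then [set - e_u j]
  else if ulo 0 j - u t 0 j < 0 then [set 0]
  else convex_hull [set - e_u j; 0].

Definition subphi3 : set E :=
  \msum_(j < m) minkowski_add (subphi3_upper j) (subphi3_lower j).
Definition supphi3 : set E := [set 0].

Definition subphi4 : set E :=
  [set (x t - x0 - vintegral 0 t z,
        - vintegral t T (fun s => x s - x0 - vintegral 0 s z), 0)].
Definition supphi4 : set E := [set 0].

Definition subphi : set E :=
  minkowski_add (minkowski_add (minkowski_add subphi1 subphi2) subphi3) subphi4.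
Definition supphi : set E :=
  minkowski_add (minkowski_add (minkowski_add supphi1 supphi2) supphi3) supphi4.

End summands.

(* Lebesgue (not only Borel) measurability on [0, T], componentwise. *)
Definition lebesgue_measurable_fun (g : R -> R) :=
  measurable_fun (`[0, T]%classic :
      set (g_sigma_algebraType (completed_algebra_gen (@lebesgue_measure R)))) g.

Definition measurable_selection (F : R -> set E) (w : R -> E) :=
  [/\ forall i : 'I_n, lebesgue_measurable_fun (fun t => (w t).1.1 0 i),
      forall i : 'I_n, lebesgue_measurable_fun (fun t => (w t).1.2 0 i),
      forall j : 'I_m, lebesgue_measurable_fun (fun t => (w t).2 0 j) &
      forall t, t \in `[0, T] -> F t (w t)].

Definition inclusion_condition (x z : R -> 'rV[R]_n) (u : R -> 'rV[R]_m) :=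
  forall w : R -> E, measurable_selection (supphi x z u) w ->
    {ae @lebesgue_measure R,
      forall t, t \in `[0, T] -> subphi x z u t (- w t)}.

End control_problem.

(* Main.v *)
(** Necessity: on an admissible trajectory all residuals vanish and, by the
    fundamental theorem of calculus, x(t) = x0 + int_0^t z, so every selection
    is w = sum_i (b_i - a_i) with a_i and b_i in the two quasidifferential sets
    of f_i, and a_i - b_i is the midpoint of e_i - 2 b_i and -e_i + 2 a_i; the
    inclusion thus holds at every t.  Sufficiency: each summand of I is
    nonnegative, hence zero, and a nonnegative piecewise continuous integrand
    with zero integral vanishes at every point of [0, T], because it is
    right-continuous on [0, T[ and left-continuous at T. *)
Require Import Defs.
From HB Require Import structures.
From mathcomp Require Import all_boot all_order all_algebra.
From mathcomp Require Import all_classical all_reals all_analysis.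
From mathcomp Require Import measurable_realfun lra.
Set Implicit Arguments.
Unset Strict Implicit.
Unset Printing Implicit Defensive.
Import Order.TTheory GRing.Theory Num.Theory.
Import numFieldNormedType.Exports.
Local Open Scope classical_set_scope.
Local Open Scope ring_scope.

(* [piecewise_continuous] for values in any topological space, so that it is
   preserved by pairing and by composition with a continuous map. *)
Definition piecewise_cont (R : realType) (T : R) (V : topologicalType)
    (y : R -> V) :=
  [/\ forall t, t \in `[0, T[ -> y s @[s --> t^'+] --> y t,
      y s @[s --> T^'-] --> y T,
      forall t, t \in `]0, T[ -> exists l : V, y s @[s --> t^'-] --> l &
      exists D : seq R, forall t, t \in `]0, T[ -> t \notin D ->
        {for t, continuous y}].

(** * Piecewise continuous functions: closure properties and integrability *)

Section piecewise_cont_theory.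
Variables (R : realType) (T : R).
Hypothesis T0 : 0 < T.

Lemma piecewise_contP (k : nat) (y : R -> 'rV[R]_k) :
  piecewise_continuous T y -> piecewise_cont T y.
Proof.
by move=> [yr yT yl yD]; split=> // t /yl /cvg_ex.
Qed.

Lemma continuous_piecewise_cont (V : pseudoMetricNormedZmodType R)
    (y : R -> V) :
  {within `[0, T], continuous y} -> piecewise_cont T y.
Proof.
move=> /(continuous_within_itvP _ T0)[yi y0 yT]; split=> //.
- move=> t; rewrite in_itv/= => /andP[].
  rewrite le_eqVlt => /predU1P[<-//|t0 tT].
  by apply: cvg_at_right_filter; apply: yi; rewrite in_itv/= t0.
- by move=> t /yi yt; exists (y t); apply: cvg_at_left_filter.
- by exists [::] => t /yi.
Qed.

Lemma piecewise_cont_pair (V W : topologicalType) (y : R -> V) (z : R -> W) :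
  piecewise_cont T y -> piecewise_cont T z ->
  piecewise_cont T (fun t => (y t, z t)).
Proof.
move=> [yr yT yl [D yD]] [zr zT zl [E zE]]; split.
- by move=> t tT; apply: cvg_pair; [exact: yr|exact: zr].
- exact: cvg_pair.
- move=> t tT; have [[a ya] [b zb]] := (yl _ tT, zl _ tT).
  by exists (a, b); apply: cvg_pair.
- exists (D ++ E) => t tT; rewrite mem_cat negb_or => /andP[tD tE].
  by apply: cvg_pair; [exact: yD|exact: zE].
Qed.

Lemma piecewise_cont_comp (V W : topologicalType) (F : V * R -> W)
    (y : R -> V) :
  {within [set p | p.2 \in `[0, T]], continuous F} ->
  piecewise_cont T y -> piecewise_cont T (fun t => F (y t, t)).
Proof.
move=> /subspace_continuousP cF [yr yT yl [D yD]].
(* One statement for an arbitrary filter [G] tending to [t] covers the right, left and two-sided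
   limits below. *)
have key (G : set_system R) (t : R) (l : V) : ProperFilter G ->
    G --> t -> (\forall s \near G, s \in `[0, T]) -> t \in `[0, T] ->
    y s @[s --> G] --> l -> F (y s, s) @[s --> G] --> F (l, t).
  move=> FG Gt GT tT yl'.
  suff H : (y s, s) @[s --> G] -->
      within [set p : V * R | p.2 \in `[0, T]] (nbhs (l, t)).
    exact: cvg_comp H (cF (l, t) tT).
  move=> A; rewrite /within/= => nA.
  have /(_ _ nA) : (y s, s) @[s --> G] --> (l, t) by exact: cvg_pair yl' Gt.
  by move: GT; apply: filterS2 => s sT /(_ sT).
split.
- move=> t; rewrite in_itv/= => /andP[t0 tT].
  apply: key; [exact: cvg_within| |by rewrite in_itv/= t0 ltW|apply: yr].
    near=> s; rewrite in_itv/=; apply/andP; split.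
      by apply: (le_trans t0); near: s; exact: nbhs_right_ge.
    by near: s; exact: nbhs_right_le.
  by rewrite in_itv/= t0.
- apply: key; [exact: cvg_within| |by rewrite in_itv/= lexx ltW|exact: yT].
  near=> s; rewrite in_itv/=; apply/andP; split.
    by near: s; exact: nbhs_left_ge.
  by near: s; exact: nbhs_left_le.
- move=> t tT; have [l tl] := yl _ tT; exists (F (l, t)).
  move: (tT); rewrite in_itv/= => /andP[t0 t1].
  apply: key; [exact: cvg_within| |by rewrite in_itv/= !ltW|exact: tl].
  near=> s; rewrite in_itv/=; apply/andP; split.
    by near: s; exact: nbhs_left_ge.
  by apply: (le_trans _ (ltW t1)); near: s; exact: nbhs_left_le.
- exists D => t tT tD; apply: (key (nbhs t)) => //; last 2 first.
  + exact: subset_itv_oo_cc.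
  + exact: yD.
    near=> s; apply: subset_itv_oo_cc; near: s; exact: near_in_itvoo.
Unshelve. all: by end_near. Qed.

Lemma piecewise_cont_continuous_comp (V W : topologicalType) (F : V -> W)
    (y : R -> V) :
  continuous F -> piecewise_cont T y -> piecewise_cont T (F \o y).
Proof.
move=> cF [yr yT yl [D yD]]; split.
- by move=> t tT; exact: cvg_comp (yr _ tT) (cF _).
- exact: cvg_comp yT (cF _).
- by move=> t /yl[l tl]; exists (F l); exact: cvg_comp tl (cF _).
- by exists D => t tT tD; exact: cvg_comp (yD _ tT tD) (cF _).
Qed.

(** One-sided limits bound [g] on each side of every point, and compactness of [[0, T]] makes these
    local bounds uniform. *)
Lemma piecewise_cont_bounded (g : R -> R) :
  piecewise_cont T g -> [bounded g x | x in `[0, T]].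
Proof.
move=> [gr gT gl _].
suff: \forall M \near +oo, `[0, T] `<=` [set s | `|g s| <= M].
  by [].
have /compact_near_coveringP/near_covering_withinP := @segment_compact _ 0 T.
apply => t /=.
rewrite in_itv/= => /andP[t0 tT].
have R1 : exists M, \forall s \near t, t < s -> s <= T -> `|g s| <= M.
  move: tT; rewrite le_eqVlt => /predU1P[->|tT].
    (* No [s] satisfies [T < s <= T], so any constant serves; the left side at 0 is treated
       alike. *)
    by exists 0; near=> s => /lt_geF ->.
  have /gr gt : t \in `[0, T[ by rewrite in_itv/= t0.
  have : \forall s \near t^'+, `|g s| < `|g t| + 1.
    by apply: (cvgr_norm_lt _ gt); rewrite ltrDl.
  rewrite /at_right near_withinE => H; exists (`|g t| + 1).
  by near=> s => ts _; apply/ltW; move: ts; near: s.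
have L1 : exists M, \forall s \near t, s < t -> 0 <= s -> `|g s| <= M.
  move: t0; rewrite le_eqVlt => /predU1P[<-|t0].
    by exists 0; near=> s => /lt_geF ->.
  have [l gt] : exists l : R, g s @[s --> t^'-] --> l.
    move: tT; rewrite le_eqVlt => /predU1P[->|tT]; first by exists (g T).
    by apply: gl; rewrite in_itv/= t0.
  have : \forall s \near t^'-, `|g s| < `|l| + 1.
    by apply: (cvgr_norm_lt _ gt); rewrite ltrDl.
  rewrite /at_left near_withinE => H; exists (`|l| + 1).
  by near=> s => ts _; apply/ltW; move: ts; near: s.
have [[M1 H1] [M2 H2]] := (R1, L1).
(* The punctured one-sided bounds say nothing at [t] itself, hence the extra term. *)
pose M := Num.max `|g t| (Num.max M1 M2).
suff H : \forall s \near t, s \in `[0, T] -> `|g s| <= M.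
  exists ([set s | s \in `[0, T] -> `|g s| <= M], [set N | M <= N]) => /=.
    by split; [exact: H|apply: nbhs_pinfty_ge; rewrite num_real].
  move=> [s N] /= [gs MN] sT; exact: le_trans (gs sT) MN.
near=> s; rewrite in_itv/= => /andP[s0 sT]; rewrite /M !le_max.
have [st|ts|->] := ltgtP s t; last by rewrite lexx.
  by apply/orP; right; apply/orP; right; move: st s0; near: s.
by apply/orP; right; apply/orP; left; move: ts sT; near: s.
Unshelve. all: by end_near. Qed.

(** Off the exceptional points and the endpoints, [g] is continuous on an open set; what remains is
    finite, and every function is measurable on a finite set. *)
Lemma piecewise_cont_measurable (g : R -> R) :
  piecewise_cont T g -> measurable_fun `[0, T] g.
Proof.
move=> [_ _ _ [D gD]].
have mseq (s : seq R) : measurable [set` s] /\ measurable_fun [set` s] g.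
  elim: s => [|a s [ms mf]].
    by rewrite set_nil; split => //; exact: measurable_fun_set0.
  have -> : [set` a :: s] = [set a] `|` [set` s].
    apply/seteqP; split=> x /=; rewrite inE.
      by move=> /predU1P[->|]; [left|right].
    by move=> [->|->]; rewrite ?eqxx ?orbT.
  split; first exact: measurableU.
  by apply/measurable_funU => //; split=> //; exact: measurable_fun_set1.
have oU : open (`]0, T[ `&` ~` [set` D]).
  apply: openI; first exact: interval_open.
  apply: closed_openC; apply: (accessible_finite_set_closed.1 _).
    exact: hausdorff_accessible.
  exact: finite_seq.
pose U := `]0, T[ `&` ~` [set` D].
apply: (@measurable_funS _ _ _ _ (U `|` [set` [:: 0, T & D]])).
- by apply: measurableU; [exact: open_measurable|have [] := mseq [:: 0, T & D]].
- move=> t /=; rewrite !in_itv/= !inE => /andP[]; rewrite !le_eqVlt eq_sym.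
  move=> /predU1P[->|t0] /predU1P[->|tT]; try by right; rewrite eqxx ?orbT.
  have [tD|tD] := boolP (t \in D); first by right; rewrite !orbT.
  by left; split; [apply/andP; split|exact/negP].
- have [ms mgs] := mseq [:: 0, T & D].
  apply/measurable_funU => //; first exact: open_measurable.
  split=> //; apply: open_continuous_measurable_fun => // t.
  by rewrite inE => -[tT /negP tD]; exact: gD.
Qed.

Lemma piecewise_cont_integrable (g : R -> R) :
  piecewise_cont T g -> (@lebesgue_measure R).-integrable `[0, T] (EFin \o g).
Proof.
move=> pg; apply: measurable_bounded_integrable => //.
- by rewrite /= lebesgue_measure_itv/= lte_fin T0 -EFinB ltry.
- exact: piecewise_cont_measurable.
- exact: piecewise_cont_bounded.
Qed.

End piecewise_cont_theory.

(** * Integrals of piecewise continuous functions and the fundamental theorem of calculus *)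

Section integrals.
Variables (R : realType) (T : R).
Hypothesis T0 : 0 < T.

(** The integral is at least [c * (b - a)]: compare with the constant on []a, b[], then enlarge the
    domain by nonnegativity. The comparison takes place in the extended reals, and integrability
    ensures that [fine] loses nothing. *)
Lemma Rintegral_itv_gt0 (g : R -> R) (a b c : R) :
  piecewise_cont T g -> (forall t, t \in `[0, T] -> 0 <= g t) ->
  a < b -> `]a, b[ `<=` `[0, T] -> 0 < c ->
  (forall t, t \in `]a, b[ -> c <= g t) ->
  0 < \int[@lebesgue_measure R]_(t in `[0, T]) g t.
Proof.
move=> pg g0 ab abT c0 cg; have ig := piecewise_cont_integrable T0 pg.
apply: (@lt_le_trans _ _ (c * (b - a))); first by rewrite mulr_gt0// subr_gt0.
rewrite -lee_fin /Rintegral fineK; last exact: integrable_fin_num.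
have mg : measurable_fun `[0, T] (EFin \o g).
  by apply/measurable_EFinP; exact: piecewise_cont_measurable.
apply: (@le_trans _ _ (\int[@lebesgue_measure R]_(t in `]a, b[) (g t)%:E)%E).
  have -> : (c * (b - a))%:E =
      (\int[@lebesgue_measure R]_(t in `]a, b[) c%:E)%E.
    by rewrite integral_cst//= lebesgue_measure_itv/= lte_fin ab -EFinB EFinM.
  apply: ge0_le_integral => //.
  - by move=> t _; rewrite lee_fin ltW.
  - by apply: measurable_funS mg.
apply: ge0_subset_integral => //.
Qed.

Lemma Rintegral_eq0 (g : R -> R) :
  piecewise_cont T g -> (forall t, t \in `[0, T] -> 0 <= g t) ->
  \int[@lebesgue_measure R]_(t in `[0, T]) g t = 0 ->
  forall t, t \in `[0, T] -> g t = 0.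
Proof.
move=> pg g0 ig t tT; apply/eqP; rewrite eq_le g0// andbT leNgt.
apply/negP => gt0.
have [gr gT _ _] := pg.
(* A positive value at [t] keeps [g] above half of it on an interval to the right of [t], or to the
   left when [t = T]; this contradicts the zero integral. *)
have gt2 : g t / 2 < g t by rewrite ltr_pdivrMr// ltr_pMr// ltr1n.
suff [a [b [ab abT gab]]] : exists a b, [/\ a < b, `]a, b[ `<=` `[0, T] &
    forall s, s \in `]a, b[ -> g t / 2 <= g s].
  have := Rintegral_itv_gt0 pg g0 ab abT (divr_gt0 gt0 (ltr0Sn R 1)) gab.
  by rewrite ig ltxx.
move: tT; rewrite in_itv/= => /andP[t0]; rewrite le_eqVlt => /predU1P[tT|tT].
  move: gT; rewrite -{2}tT => /cvgr_gt/(_ _ gt2).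
  rewrite /at_left near_withinE => -[e /= e0 He].
  exists (Num.max 0 (T - e)), T; split.
  - by rewrite gt_max T0 ltrBlDr ltrDl.
  - move=> s /=; rewrite !in_itv/= gt_max => /andP[/andP[s0 _] sT].
    by rewrite !ltW.
  - move=> s; rewrite in_itv/= gt_max => /andP[/andP[_ seT] sT].
    apply/ltW/He => //.
    by rewrite /= ger0_norm ?subr_ge0 ?ltW// ltrBlDl -ltrBlDr.
have /gr/cvgr_gt/(_ _ gt2) : t \in `[0, T[ by rewrite in_itv/= t0.
rewrite /at_right near_withinE => -[e /= e0 He].
exists t, (Num.min T (t + e)); split.
- by rewrite lt_min tT ltrDl.
- move=> s /=; rewrite !in_itv/= lt_min => /andP[ts /andP[sT _]].
  by rewrite (le_trans t0) ltW.
- move=> s; rewrite in_itv/= lt_min => /andP[ts /andP[_ se]].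
  apply/ltW/He => //.
  by rewrite /= distrC ger0_norm ?subr_ge0 ?ltW// ltrBlDl.
Qed.

Lemma is_derive_Rintegral (g : R -> R) : piecewise_cont T g ->
  exists D : seq R, forall t, t \in `]0, T[ -> t \notin D ->
    is_derive t 1 (fun x => \int[@lebesgue_measure R]_(s in `[0, x]) g s) (g t).
Proof.
move=> pg; have ig := piecewise_cont_integrable T0 pg.
have [_ _ _ [D gD]] := pg; exists D => t; rewrite in_itv/= => /andP[t0 tT] tD.
have /(_ _)[|dG GE] := continuous_FTC1_closed tT ig t0.
  by apply: gD => //; rewrite in_itv/= t0.
by split=> //; rewrite -GE derive1E.
Qed.

(** Induction on the list of exceptional points: an exceptional [d] inside []a, b[] splits the
    interval, and continuity of [F] at [d] glues the two halves. With no exceptions left, the mean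
    value theorem applies. *)
Lemma derive0_cst (F : R -> R) (D : seq R) (a b : R) : a <= b ->
  {within `[a, b], continuous F} ->
  (forall t, t \in `]a, b[ -> t \notin D -> is_derive t 1 F 0) ->
  F a = F b.
Proof.
elim: D a b => [|d D IH] a b; rewrite le_eqVlt => /predU1P[->//|ab] cF dF.
  have [|c _ /eqP] := @MVT _ F (fun=> 0) a b ab _ cF.
    by move=> t tab; exact: dF.
  by rewrite mul0r subr_eq0 => /eqP.
have [|dab] := boolP (d \in `]a, b[); last first.
  apply: IH => //; first exact: ltW.
  move=> t tab tD; apply: dF => //; rewrite inE negb_or tD andbT.
  by apply: contraNneq dab => <-.
rewrite in_itv/= => /andP[ad db].
have cad : {within `[a, d], continuous F}.
  by apply: continuous_subspaceW cF; apply: subset_itvl; rewrite bnd_simp ltW.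
have cdb : {within `[d, b], continuous F}.
  by apply: continuous_subspaceW cF; apply: subset_itvr; rewrite bnd_simp ltW.
have dad t : t \in `]a, d[ -> t \notin D -> is_derive t 1 F 0.
  rewrite in_itv/= => /andP[at_ td] tD; apply: dF.
    by rewrite in_itv/= at_ (lt_trans td).
  by rewrite inE negb_or tD andbT lt_eqF.
have ddb t : t \in `]d, b[ -> t \notin D -> is_derive t 1 F 0.
  rewrite in_itv/= => /andP[dt tb] tD; apply: dF.
    by rewrite in_itv/= tb (lt_trans ad).
  by rewrite inE negb_or tD andbT gt_eqF.
exact: etrans (IH a d (ltW ad) cad dad) (IH d b (ltW db) cdb ddb).
Qed.

(** [F] minus the indefinite integral of [g] is continuous with zero derivative off a finite set,
    hence constant. *)
Lemma piecewise_FTC2 (F g : R -> R) :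
  {within `[0, T], continuous F} -> piecewise_cont T g ->
  (exists D : seq R, forall t, t \in `]0, T[ -> t \notin D ->
    is_derive t 1 F (g t)) ->
  forall t, t \in `[0, T] ->
    \int[@lebesgue_measure R]_(s in `[0, t]) g s = F t - F 0.
Proof.
move=> cF pg [D dF] t; rewrite in_itv/= => /andP[t0 tT].
have ig := piecewise_cont_integrable T0 pg.
have [E dG] := is_derive_Rintegral pg.
pose G x := \int[@lebesgue_measure R]_(s in `[0, x]) g s.
have cG := parameterized_integral_continuous (ltW T0) ig.
have : F 0 - G 0 = F t - G t.
  apply: (@derive0_cst (F \- G) (D ++ E)) => //.
    apply: (@continuous_subspaceW _ _ _ `[0, T]).
      by apply: subset_itvl; rewrite bnd_simp.
    by move=> x; apply: cvgB; [exact: cF|exact: cG].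
  move=> s; rewrite in_itv/= => /andP[s0 st].
  rewrite mem_cat negb_or => /andP[sD sE].
  have sT : s \in `]0, T[ by rewrite in_itv/= s0 (lt_le_trans st).
  have dFs := dF _ sT sD; have dGs := dG _ sT sE.
  by rewrite -[0](subrr (g s)); exact: is_deriveB.
(* [G 0] is an integral over a single point, hence 0. *)
rewrite {1}/G set_itv1 Rintegral_set1 subr0 => /eqP; rewrite -/(G t) => /eqP ->.
by rewrite opprB addrC subrK.
Qed.

End integrals.

(** * Minkowski sums and convex hulls *)

Section minkowski.
Variable V : zmodType.

Lemma msum_opp (k : nat) (A B : 'I_k -> set V) :
  (forall i v, A i v -> B i (- v)) ->
  forall v, (\msum_(i < k) A i) v -> (\msum_(i < k) B i) (- v).
Proof.
move=> AB.
apply: (big_ind2 (fun S S' : set V => forall v, S v -> S' (- v))).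
- by move=> v /= ->; rewrite oppr0.
- move=> S1 S1' S2 S2' h1 h2 _ [a /h1 Sa [b /h2 Sb <-]].
  by exists (- a) => //; exists (- b) => //; rewrite opprD.
- by move=> i _; exact: AB.
Qed.

Lemma msum0 (k : nat) (A : 'I_k -> set V) :
  (forall i, A i 0) -> (\msum_(i < k) A i) 0.
Proof.
move=> A0; apply: (big_ind (fun S : set V => S 0)) => // S S' S0 S'0.
by exists 0 => //; exists 0 => //; rewrite addr0.
Qed.

End minkowski.

Lemma convex_hull_sub (R : realType) (V : lmodType R) (A : set V) :
  A `<=` convex_hull A.
Proof. by move=> a Aa C [_ sAC]; exact: sAC. Qed.

Lemma convex_hull_midpoint (R : realType) (V : lmodType R) (A : set V)
    (a b : V) :
  A a -> A b -> convex_hull A (2^-1 *: (a + b)).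
Proof.
move=> Aa Ab C [cC sAC]; apply/set_mem.
have l1 : 2^-1 <= 1 :> R by rewrite invf_le1// ler1n.
have l0 : 0 <= 2^-1 :> R by rewrite invr_ge0.
have := cC a b (Itv01 l0 l1) (mem_set (sAC _ Aa)) (mem_set (sAC _ Ab)).
rewrite /conv/= /unstable.onem (_ : 1 - 2^-1 = 2^-1 :> R) ?scalerDr//.
by lra.
Qed.


(** * Necessity: the inclusion along an admissible trajectory *)

Section necessity.
Variables (R : realType) (n m : nat) (T : R) (x0 xT : 'rV[R]_n).
Variables (ulo uhi : 'rV[R]_m) (f : 'rV[R]_n -> 'rV[R]_m -> R -> 'rV[R]_n).
Variables (subf supf :
  'I_n -> 'rV[R]_n -> 'rV[R]_m -> R -> set ('rV[R]_n * 'rV[R]_m)).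

Lemma is_derive_coord (x : R -> 'rV[R]_n) (t : R) (v : 'rV[R]_n) (i : 'I_n) :
  is_derive t 1 x v -> is_derive t 1 (fun s => x s 0 i) (v 0 i).
Proof.
move=> [dx xv]; split; first exact: (derivable_mxP x t 1).1 dx 0 i.
by rewrite -xv derive_mx// mxE.
Qed.

Lemma coord_is_derive (x : R -> 'rV[R]_n) (t : R) (v : 'rV[R]_n) :
  (forall i, is_derive t 1 (fun s => x s 0 i) (v 0 i)) -> is_derive t 1 x v.
Proof.
move=> dx; have dx' : derivable x t 1.
  by apply/derivable_mxP => i j; rewrite ord1; have [] := dx j.
split => //; apply/rowP => i; rewrite derive_mx// mxE.
by have [_ ->] := dx i.
Qed.

Lemma continuous_on_coord (x : R -> 'rV[R]_n) (i : 'I_n) :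
  continuous_on T x -> {within `[0, T], continuous (fun t => x t 0 i)}.
Proof.
by move=> cx s; exact: cvg_comp (cx s) (@coord_continuous R 1 n 0 i (x s)).
Qed.

Lemma trajectory_vintegral (x z : R -> 'rV[R]_n) (u : R -> 'rV[R]_m) :
  0 < T -> trajectory T x0 f x z u ->
  forall t, t \in `[0, T] -> vintegral 0 t z = x t - x0.
Proof.
move=> T0 [cx [pz [D dx]] <- _] t tT; apply/rowP => i; rewrite !mxE.
apply: (@piecewise_FTC2 _ T T0 (fun t => x t 0 i) (fun t => z t 0 i)) => //.
- exact: continuous_on_coord.
- apply: (@piecewise_cont_continuous_comp _ _ _ _ (fun v : 'rV[R]_n => v 0 i)).
    exact: coord_continuous.
  exact: piecewise_contP.
- by exists D => s sT sD; apply: is_derive_coord; exact: dx.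
Qed.

Lemma subphi1_supphi1 (x z : R -> 'rV[R]_n) (u : R -> 'rV[R]_m) (t : R) v :
  z t = f (x t) (u t) t ->
  supphi1 f subf supf x z u t v -> subphi1 f subf supf x z u t (- v).
Proof.
move=> zf; apply: msum_opp => i w.
rewrite /supphi1_term /subphi1_term /residual zf subrr ltxx.
move=> [_ [a fa <-] [b fb <-]].
(* The residual is 0, so both terms are in their third branch, and [a - b] is the midpoint of one
   point from each set under the hull. *)
have -> : - (0 + -1 *: a + b) =
    2^-1 *: ((e_z R m i + (- 2) *: b) + (- e_z R m i + 2 *: a)).
  rewrite addrACA subrr !add0r scalerDr !scalerA mulrN mulVf//.
  by rewrite !scaleN1r scale1r opprD opprK addrC.
apply: convex_hull_midpoint.
  by left; exists b.
by right; exists a.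
Qed.

(** The control bounds exclude the strictly positive branches, and each remaining branch contains
    0. *)
Lemma subphi3_0 (u : R -> 'rV[R]_m) (t : R) :
  (forall j, ulo 0 j <= u t 0 j <= uhi 0 j) -> @subphi3 R n m ulo uhi u t 0.
Proof.
move=> ub; apply: msum0 => j; have /andP[lo hi] := ub j.
exists 0; last (exists 0; last by rewrite addr0).
  rewrite /subphi3_upper subr_gt0 ltNge hi/=.
  by case: ifP => // _; apply: convex_hull_sub; right.
rewrite /subphi3_lower subr_gt0 ltNge lo/=.
by case: ifP => // _; apply: convex_hull_sub; right.
Qed.

Lemma vintegral0 (k : nat) (a b : R) (y : R -> 'rV[R]_k) :
  (forall t, t \in `[a, b] -> y t = 0) -> vintegral a b y = 0.
Proof.
move=> y0; apply/rowP => i; rewrite !mxE.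
under eq_Rintegral => t /set_mem/y0 -> do rewrite mxE.
by rewrite Rintegral_cst// mul0r.
Qed.

Lemma trajectory_inclusion (x z : R -> 'rV[R]_n) (u : R -> 'rV[R]_m) :
  0 < T -> admissible_control T ulo uhi u -> trajectory T x0 f x z u ->
  x T = xT -> inclusion_condition T x0 xT ulo uhi f subf supf x z u.
Proof.
move=> T0 [_ ub] tx xTE w [_ _ _ sw].
have xE := trajectory_vintegral T0 tx.
have [_ _ _ zf] := tx.
(* The inclusion is proved at every [t], which is stronger than almost everywhere. *)
apply: aeW => t tT.
(* The last three summands of [supphi] are [[set 0]], so [w t] is an element [a] of [supphi1].
   Accordingly [- w t] is split as [- a] plus three zeros, peeled off from [subphi4] inwards. *)
have [_ [_ [a sa [_ -> <-]] [_ -> <-]] [_ -> <-]] := sw _ tT.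
rewrite !addr0.
exists (- a); last first.
  (* The integral equation holds at [t] and on all of [[t, T]], so both components of the [subphi4]
     vector vanish. *)
  exists 0; rewrite ?addr0 // /subphi4 /= xE// subrr vintegral0 ?oppr0// => s.
  move: tT; rewrite !in_itv/= => /andP[t0 tT] /andP[ts sT].
  by rewrite xE ?subrr// in_itv/= sT (le_trans t0).
exists (- a); last first.
  by exists 0; rewrite ?addr0//; apply: subphi3_0 => j; exact: ub.
exists (- a); first by apply: subphi1_supphi1 sa; exact: zf.
exists 0; rewrite ?addr0 // /subphi2 /= xE; last by rewrite in_itv/= lexx ltW.
by rewrite (addrC x0) subrK xTE subrr.
Qed.

End necessity.

(** * Sufficiency: consequences of a zero value of the functional *)

Lemma sqnormv_eq0 (R : realType) (k : nat) (v : 'rV[R]_k) :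
  sqnormv v = 0 -> v = 0.
Proof.
move=> v0; apply/rowP => i; rewrite mxE; apply/eqP; rewrite -sqrf_eq0 expr2.
apply/eqP; apply: (psumr_eq0P _ v0) => // j _.
by rewrite -expr2 sqr_ge0.
Qed.

Lemma sqnormv_ge0 (R : realType) (k : nat) (v : 'rV[R]_k) : 0 <= sqnormv v.
Proof. by apply: sumr_ge0 => i _; rewrite -expr2 sqr_ge0. Qed.

Section sufficiency.
Variables (R : realType) (n m : nat) (T : R) (x0 xT : 'rV[R]_n).
Variables (ulo uhi : 'rV[R]_m) (f : 'rV[R]_n -> 'rV[R]_m -> R -> 'rV[R]_n).
Variables (x z : R -> 'rV[R]_n) (u : R -> 'rV[R]_m).
Hypotheses (T0 : 0 < T) (cf : rhs_continuous T f).
Hypotheses (cx : continuous_on T x) (pz : piecewise_continuous T z).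
Hypothesis pu : piecewise_continuous T u.

Lemma piecewise_cont_coord (k : nat) (y : R -> 'rV[R]_k) (i : 'I_k) :
  piecewise_continuous T y -> piecewise_cont T (fun t => y t 0 i).
Proof.
move=> /piecewise_contP py.
apply: (@piecewise_cont_continuous_comp _ _ _ _ (fun v : 'rV[R]_k => v 0 i)) py.
exact: coord_continuous.
Qed.

(** Continuity of [f] over the strip makes the right-hand side along [(x, u)] piecewise continuous;
    pairing with [z] and a continuous map give the residual. *)
Lemma residual_piecewise_cont (i : 'I_n) :
  piecewise_cont T (fun t => `|z t 0 i - f (x t) (u t) t 0 i|).
Proof.
have px : piecewise_cont T x by exact: continuous_piecewise_cont.
have := piecewise_cont_pair px (piecewise_contP pu).
move/(piecewise_cont_comp T0 cf)/(piecewise_cont_pair (piecewise_contP pz)).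
apply: (@piecewise_cont_continuous_comp _ _ _ _
  (fun p : 'rV[R]_n * 'rV[R]_n => `|p.1 0 i - p.2 0 i|)) => p.
apply: cvg_norm; apply: cvgB.
  apply: (@cvg_comp _ _ _ fst (fun v : 'rV[R]_n => v 0 i)).
    exact: cvg_fst.
  exact: coord_continuous.
apply: (@cvg_comp _ _ _ snd (fun v : 'rV[R]_n => v 0 i)); first exact: cvg_snd.
exact: coord_continuous.
Qed.

(** The function is in fact continuous on [[0, T]], because the integral of [z] depends continuously
    on its upper limit. *)
Lemma integral_equation_piecewise_cont :
  piecewise_cont T (fun t => sqnormv (x t - x0 - vintegral 0 t z)).
Proof.
apply: continuous_piecewise_cont => // t; rewrite /sqnormv /dotv.
apply: cvg_big => [|i _]; first exact: add_continuous.
have h : {within `[0, T],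
    continuous (fun t => (x t - x0 - vintegral 0 t z) 0 i)}.
  move=> s.
  have -> : (fun t => (x t - x0 - vintegral 0 t z) 0 i) =
      (fun t => x t 0 i - x0 0 i -
        parameterized_integral (@lebesgue_measure R) 0 t (fun s => z s 0 i)).
    by apply/funext => r; rewrite !mxE.
  apply: cvgB; last first.
    apply: (parameterized_integral_continuous (ltW T0)).
    exact: piecewise_cont_integrable (piecewise_cont_coord i pz).
  apply: cvgB; last exact: cvg_cst.
  exact: (continuous_on_coord cx).
by apply: cvgM; exact: h.
Qed.

Lemma max0_comp_piecewise_cont (h : R -> R) (j : 'I_m) :
  continuous h -> piecewise_cont T (fun t => Num.max (h (u t 0 j)) 0).
Proof.
move=> ch.
apply: (@piecewise_cont_continuous_comp _ _ _ _ (fun r : R => Num.max (h r) 0))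
  (piecewise_cont_coord j pu) => r.
by apply: continuous_max; [exact: ch|exact: cvg_cst].
Qed.

Lemma functional_eq0P : functional T x0 xT ulo uhi f x z u = 0 ->
  [/\ forall t, t \in `[0, T] -> z t = f (x t) (u t) t,
      x0 + vintegral 0 T z = xT,
      forall j t, t \in `[0, T] -> ulo 0 j <= u t 0 j <= uhi 0 j &
      forall t, t \in `[0, T] -> x t = x0 + vintegral 0 t z].
Proof.
rewrite /functional.
set a1 := \sum_(i < n) _; set a2 := sqnormv _; set a3 := \sum_(j < m) _.
set a4 := \sum_(j < m) _; set a5 := Rintegral _ _ _ => I0.
have i1 i : 0 <= \int[@lebesgue_measure R]_(t in `[0, T])
    `|z t 0 i - f (x t) (u t) t 0 i| by apply: Rintegral_ge0 => t _.
have i3 j : 0 <= \int[@lebesgue_measure R]_(t in `[0, T])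
    Num.max (ulo 0 j - u t 0 j) 0.
  by apply: Rintegral_ge0 => t _; rewrite le_max lexx orbT.
have i4 j : 0 <= \int[@lebesgue_measure R]_(t in `[0, T])
    Num.max (u t 0 j - uhi 0 j) 0.
  by apply: Rintegral_ge0 => t _; rewrite le_max lexx orbT.
have p1 : 0 <= a1 by apply: sumr_ge0.
have p2 : 0 <= a2 by exact: sqnormv_ge0.
have p3 : 0 <= a3 by apply: sumr_ge0.
have p4 : 0 <= a4 by apply: sumr_ge0.
have p5 : 0 <= a5 by apply: Rintegral_ge0 => t _; exact: sqnormv_ge0.
have [e1 e2 e3 e4 e5] : [/\ a1 = 0, a2 = 0, a3 = 0, a4 = 0 & a5 = 0].
  by split; lra.
split.
- move=> t tT; apply/rowP => i; apply/eqP; rewrite -subr_eq0 -normr_eq0.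
  apply/eqP; apply: (Rintegral_eq0 T0 (residual_piecewise_cont i)) tT => //.
  exact: (psumr_eq0P _ e1).
- by apply/eqP; rewrite -subr_eq0; apply/eqP/sqnormv_eq0.
- move=> j t tT; apply/andP; split; rewrite -subr_le0.
    (* Replacing the bound 0 by the maximum leaves a term compared with a maximum that contains
       it. *)
    suff <- : Num.max (ulo 0 j - u t 0 j) 0 = 0 by rewrite le_max lexx.
    apply: (Rintegral_eq0 T0
      (@max0_comp_piecewise_cont (fun r => ulo 0 j - r) j _) _ _ tT).
    + by move=> r; apply: cvgB; [exact: cvg_cst|exact: cvg_id].
    + by move=> s _; rewrite le_max lexx orbT.
    + exact: (psumr_eq0P _ e3).
  suff <- : Num.max (u t 0 j - uhi 0 j) 0 = 0 by rewrite le_max lexx.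
  apply: (Rintegral_eq0 T0
    (@max0_comp_piecewise_cont (fun r => r - uhi 0 j) j _) _ _ tT).
  + by move=> r; apply: cvgB; [exact: cvg_id|exact: cvg_cst].
  + by move=> s _; rewrite le_max lexx orbT.
  + exact: (psumr_eq0P _ e4).
- move=> t tT; apply/eqP; rewrite -subr_eq0 opprD addrA.
  apply/eqP/sqnormv_eq0.
  apply: (Rintegral_eq0 T0 integral_equation_piecewise_cont _ e5) tT.
  by move=> s _; exact: sqnormv_ge0.
Qed.

Lemma functional_eq0_steers : functional T x0 xT ulo uhi f x z u = 0 ->
  admissible_control T ulo uhi u /\ steers T x0 xT f u.
Proof.
move=> /functional_eq0P[zf xTE ub xE]; split; first by split.
exists x, z; split; last by rewrite xE ?xTE// in_itv/= lexx ltW.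
split => //; last first.
  rewrite xE ?in_itv/= ?lexx ?ltW//; apply/rowP => i.
  by rewrite !mxE set_itv1 Rintegral_set1 addr0.
split => //.
(* Each coordinate has its own finite exceptional set; their concatenation serves for the vector
   derivative. *)
have /choice[D dD] : forall i : 'I_n, exists D : seq R, forall t,
    t \in `]0, T[ -> t \notin D -> is_derive t 1
      (fun s => \int[@lebesgue_measure R]_(r in `[0, s]) z r 0 i) (z t 0 i).
  by move=> i; exact: is_derive_Rintegral (piecewise_cont_coord i pz).
exists (flatten [seq D i | i <- enum 'I_n]) => t tT tD.
apply: coord_is_derive => i.
have tDi : t \notin D i.
  apply: contra tD => tDi; apply/flattenP; exists (D i) => //.
  by apply/mapP; exists i; rewrite ?mem_enum.
have dG := dD i t tT tDi.
pose G s := x0 0 i + \int[@lebesgue_measure R]_(r in `[0, s]) z r 0 i.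
(* [x] is known to equal [G] only on [[0, T]], but [t] is interior, so they agree near [t] and the
   derivative carries over. *)
have GE : \forall s \near t, G s = x s 0 i.
  near=> s; rewrite xE; first by rewrite !mxE.
  by apply: subset_itv_oo_cc; near: s; exact: near_in_itvoo.
have dG' : is_derive t 1 G (z t 0 i).
  by rewrite -[z t 0 i]add0r; exact: is_deriveD.
exact: near_eq_is_derive GE dG'.
Unshelve. all: by end_near. Qed.

End sufficiency.

Theorem theorem5p3 (R : realType) (n m : nat) (T : R)
    (x0 xT : 'rV[R]_n) (ulo uhi : 'rV[R]_m)
    (f : 'rV[R]_n -> 'rV[R]_m -> R -> 'rV[R]_n)
    (subf supf :
      'I_n -> 'rV[R]_n -> 'rV[R]_m -> R -> set ('rV[R]_n * 'rV[R]_m)) :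
  0 < T ->
  rhs_continuous T f ->
  rhs_quasidifferentials T f subf supf ->
  rhs_locally_lipschitz T f ->
  (exists u : R -> 'rV[R]_m,
    admissible_control T ulo uhi u /\ steers T x0 xT f u) ->
  (forall (x z : R -> 'rV[R]_n) (u : R -> 'rV[R]_m),
    admissible_control T ulo uhi u ->
    trajectory T x0 f x z u -> x T = xT ->
    inclusion_condition T x0 xT ulo uhi f subf supf x z u)
  /\
  (forall (x z : R -> 'rV[R]_n) (u : R -> 'rV[R]_m),
    continuous_on T x -> piecewise_continuous T z ->
    piecewise_continuous T u ->
    functional T x0 xT ulo uhi f x z u = 0 ->
    inclusion_condition T x0 xT ulo uhi f subf supf x z u ->
    admissible_control T ulo uhi u /\ steers T x0 xT f u).
Proof.
move=> T0 cf _ _ _; split.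
  by move=> x z u au tx xTE; exact: trajectory_inclusion.
by move=> x z u cx pz pu I0 _; exact: (functional_eq0_steers T0 cf cx pz pu I0).
Qed.
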